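(* Let $a\ge 0$ and $b>0$ be real numbers, and let $\mathcal{C}_n(a,b)$, $n\ge0$, be the generalized Catalan numbers of the second kind, i.e. the coefficients in the power series expansion around $x=0$ $$\frac{1}{a+\sqrt{b-x}}=\sum_{n=0}^{\infty}\mathcal{C}_n(a,b)\,x^n .$$ Then for every integer $n\ge 0$, $$\mathcal{C}_n(a,b)=\frac{1}{(2n)!!\,b^{n+1/2}}\sum_{k=0}^{n}\binom{2n-k-1}{2(n-k)}\frac{k!\,[2(n-k)-1]!!}{\bigl(1+a/\sqrt{b}\,\bigr)^{k+1}},$$ where the double factorial of negative odd integers is defined by $(-2\ell-1)!!=\frac{(-1)^\ell}{(2\ell-1)!!}=(-1)^\ell\frac{(2\ell)!!}{(2\ell)!}$ for $\ell\ge0$.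
   Context: Double factorials: $(2n)!!=\prod_{j=1}^{n}(2j)=2^n n!$ (so $0!!=1$), $(2m-1)!!=\prod_{j=1}^{m}(2j-1)$ for $m\ge1$, and $(-1)!!=1$ (the case $\ell=0$ of the convention for negative odd integers). Binomial coefficients are $\binom{m}{j}=\frac{m(m-1)\cdots(m-j+1)}{j!}$ for integers $m$ and $j\ge0$; in particular $\binom{-1}{0}=1$ (occurring for $n=k=0$) and $\binom{2n-1}{2n}=0$ for $n\ge1$. The square root is the nonnegative real square root, and the power series is the Taylor series at $x=0$ of the function $x\mapsto 1/(a+\sqrt{b-x})$, valid near $x=0$. *)

(* Defs.v *)
From Stdlib Require Import Reals ZArith Arith Lia Lra.
From Coquelicot Require Import Coquelicot.

Open Scope R_scope.

Fixpoint dfact_nat (n : nat) : nat :=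
  match n with
  | S (S m) => n * dfact_nat m
  | _ => 1
  end%nat.

(* Extension of the double factorial to the negative odd integers by
   (-2l-1)!! = (-1)^l (2l)!! / (2l)! for l >= 0; in particular (-1)!! = 1.
   The value at a negative even integer is meaningless. *)
Definition dfact (z : Z) : R :=
  if (0 <=? z)%Z then INR (dfact_nat (Z.to_nat z))
  else
    let l := Z.to_nat ((- z - 1) / 2) in
    (-1) ^ l * INR (dfact_nat (2 * l)) / INR (fact (2 * l)).

(* m (m-1) ... (m-j+1) *)
Fixpoint falling (m : Z) (j : nat) : Z :=
  match j with
  | O => 1
  | S i => falling m i * (m - Z.of_nat i)
  end%Z.

(* Integer upper argument: Stdlib's [C] takes only natural numbers, and its
   value is not 0 when the lower argument exceeds the upper one. *)
Definition binomZ (m : Z) (j : nat) : R := IZR (falling m j) / INR (fact j).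

Definition gen_catalan2_fun (a b x : R) : R := 1 / (a + sqrt (b - x)).

(* Taylor coefficient at 0. [Derive_n] is total, so this alone does not say
   that the Taylor series converges to the function near 0. *)
Definition gen_catalan2 (a b : R) (n : nat) : R :=
  Derive_n (gen_catalan2_fun a b) n 0 / INR (fact n).

Lemma dfact_nat_even (n : nat) : dfact_nat (2 * n) = (2 ^ n * fact n)%nat.
Proof.
induction n as [|n IH]; [reflexivity|].
replace (2 * S n)%nat with (S (S (2 * n))) by lia.
change (dfact_nat (S (S (2 * n)))) with (S (S (2 * n)) * dfact_nat (2 * n))%nat.
rewrite IH, fact_simpl, Nat.pow_succ_r'; ring.
Qed.

Lemma dfact_nat_odd (m : nat) :
  (dfact_nat (2 * m + 1) = (2 * m + 1) * dfact_nat (2 * m - 1))%nat.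
Proof.
destruct m as [|m]; [reflexivity|].
replace (2 * S m + 1)%nat with (S (S (2 * m + 1))) by lia.
replace (2 * S m - 1)%nat with (2 * m + 1)%nat by lia.
reflexivity.
Qed.

Lemma dfact_neg_odd (l : nat) :
  dfact (- 2 * Z.of_nat l - 1)
  = (-1) ^ l * INR (dfact_nat (2 * l)) / INR (fact (2 * l)).
Proof.
unfold dfact.
destruct (Z.leb_spec 0 (- 2 * Z.of_nat l - 1)) as [H|H]; [lia|].
replace ((- (- 2 * Z.of_nat l - 1) - 1) / 2)%Z with (Z.of_nat l).
- now rewrite Nat2Z.id.
- replace (- (- 2 * Z.of_nat l - 1) - 1)%Z with (Z.of_nat l * 2)%Z by lia.
  now rewrite Z.div_mul.
Qed.

(* Main.v *)
Require Import Defs.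
From Stdlib Require Import Reals ZArith.
From Coquelicot Require Import Coquelicot.
From Stdlib Require Import Lia Lra.

(** Put [y = 1 / (a + sqrt (b - x))] and [u = 1 / sqrt (b - x)]. Then
    [y' = y^2 u / 2] and [u' = u^3 / 2], so differentiation sends a monomial
    [y^(k+1) u^m] to half of [(k+1) y^(k+2) u^(m+1) + m y^(k+1) u^(m+2)].
    Iterating from [y], for all [x < b],
<<
      y^(n) = 2^-n * sum_(k <= n) k! B(n,k) y^(k+1) u^(2n-k),
      B(n+1,k+1) = B(n,k) + (2n-k-1) B(n,k+1),
>>
    and the [B(n,k)] are Bessel numbers, which the recurrence identifies with
    [binom(2n-k-1, 2(n-k)) (2(n-k)-1)!!] ([bessel_binomZ_dfact]). At [x = 0]
    one has [u = 1/sqrt b] and [y = u / (1 + a / sqrt b)], hence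
    [y^(k+1) u^(2n-k) = b^-(n+1/2) / (1 + a / sqrt b)^(k+1)], and division by
    [n!] gives the formula ([gen_catalan2_bessel]).

    The same expression controls the Taylor remainder. All its terms are
    nonnegative and [y <= u] because [a >= 0], so
    [|y^(n)| <= u^(2n+1) 2^-n sum_k k! B(n,k)]. That last sum is
    [1 * 3 * ... * (2n-1) <= 2^n n!], whence [|y^(n)| <= n! u (b-x)^-n]
    ([Derive_n_gen_catalan2_fun_bound]). On [|x| < b/2] this is a bound
    [K n! / (b/2)^n], and Lagrange's form of the remainder then tends to [0]
    like a geometric sequence ([taylor_series_of_cauchy_bound]). *)

Open Scope R_scope.

(** * Convergence of Taylor series under Cauchy estimates *)

(** The hypothesis bounds the Lagrange remainder of order [n] at [x] by
    [K (x/r)^(n+1)]. *)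
Lemma taylor_series_of_cauchy_bound_pos (f : R -> R) (r K : R) :
  (forall n t, Rabs t < r -> ex_derive_n f n t) ->
  (forall n t, Rabs t < r ->
     Rabs (Derive_n f n t) <= K * INR (fact n) / r ^ n) ->
  forall x, 0 < x < r ->
  is_pseries (fun n => Derive_n f n 0 / INR (fact n)) x (f x).
Proof.
intros Hex Hbd x Hx.
apply is_pseries_R.
change (is_lim_seq (sum_n (fun n => Derive_n f n 0 / INR (fact n) * x ^ n)) (f x)).
assert (Hq : Rabs (x / r) < 1).
{ rewrite Rabs_pos_eq.
  - apply Rlt_div_l; lra.
  - apply Rdiv_le_0_compat; lra. }
set (P := sum_n (fun n => Derive_n f n 0 / INR (fact n) * x ^ n)).
assert (Hrem : forall n, Rabs (P n - f x) <= K * (x / r * (x / r) ^ n)).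
{ intro n.
  destruct (Taylor_Lagrange f n 0 x) as [z [Hz Heq]]; [lra| |].
  { intros t Ht k _; apply Hex; rewrite Rabs_pos_eq; lra. }
  assert (HP : P n = sum_f_R0
      (fun m : nat => (x - 0) ^ m / INR (fact m) * Derive_n f m 0) n).
  { unfold P; rewrite sum_n_Reals; apply sum_eq; intros i _.
    rewrite Rminus_0_r; unfold Rdiv; ring. }
  rewrite Heq, <- HP, Rminus_0_r.
  replace (P n - _) with (- (x ^ S n / INR (fact (S n)) * Derive_n f (S n) z)) by ring.
  assert (Hz' : Rabs z < r) by (rewrite Rabs_pos_eq; lra).
  pose proof (Hbd (S n) z Hz') as HB.
  pose proof (INR_fact_lt_0 (S n)) as Hf.
  rewrite Rabs_Ropp, Rabs_mult, Rabs_pos_eq.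
  2: { apply Rdiv_le_0_compat; [apply pow_le|]; lra. }
  apply Rle_trans with (x ^ S n / INR (fact (S n)) * (K * INR (fact (S n)) / r ^ S n)).
  - apply Rmult_le_compat_l; [|exact HB].
    apply Rdiv_le_0_compat; [apply pow_le|]; lra.
  - apply Req_le.
    change (x / r * (x / r) ^ n) with ((x / r) ^ S n).
    replace ((x / r) ^ S n) with (x ^ S n / r ^ S n)
      by (unfold Rdiv; rewrite Rpow_mult_distr, pow_inv; reflexivity).
    field; split; [apply pow_nonzero|]; lra. }
assert (Hlim : is_lim_seq (fun n => K * (x / r * (x / r) ^ n)) 0).
{ replace (Finite 0) with (Rbar_mult K (Rbar_mult (x / r) 0)).
  - apply is_lim_seq_scal_l, is_lim_seq_scal_l, is_lim_seq_geom, Hq.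
  - simpl; f_equal; ring. }
assert (H0 : is_lim_seq (fun n => P n - f x) 0).
{ apply is_lim_seq_abs_0.
  apply is_lim_seq_le_le with (u := fun _ => 0) (w := fun n => K * (x / r * (x / r) ^ n)).
  - intro n; split; [apply Rabs_pos|apply Hrem].
  - apply is_lim_seq_const.
  - exact Hlim. }
apply is_lim_seq_ext with (fun n => (P n - f x) + f x); [intro; ring|].
replace (Finite (f x)) with (Finite (0 + f x)) by (f_equal; ring).
apply is_lim_seq_plus'; [exact H0|apply is_lim_seq_const].
Qed.

(** Negative [x] are reached by applying the positive case to [t => f (-t)],
    which satisfies the same estimates. *)
Lemma taylor_series_of_cauchy_bound (f : R -> R) (r K : R) :
  (forall n t, Rabs t < r -> ex_derive_n f n t) ->
  (forall n t, Rabs t < r ->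
     Rabs (Derive_n f n t) <= K * INR (fact n) / r ^ n) ->
  forall x, Rabs x < r ->
  is_pseries (fun n => Derive_n f n 0 / INR (fact n)) x (f x).
Proof.
intros Hex Hbd x Hx.
destruct (Rtotal_order x 0) as [Hneg|[->|Hpos]].
- assert (Hloc : forall n t, Rabs t < r -> locally (- t)
      (fun y => forall k, (k <= n)%nat -> ex_derive_n f k y)).
  { intros n t Ht.
    apply (locally_interval _ (- t) (- r) r); simpl;
      try (apply Rabs_def2 in Ht; lra).
    intros y Hy1 Hy2 k _; apply Hex, Rabs_def1; assumption. }
  assert (Hr : 0 < r) by (pose proof (Rabs_pos x); lra).
  assert (Hser := taylor_series_of_cauchy_bound_pos (fun t => f (- t)) r K).
  specialize (Hser (fun n t Ht => ex_derive_n_comp_opp f n t (Hloc n t Ht))).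
  assert (H : is_pseries
      (fun n => Derive_n (fun t => f (- t)) n 0 / INR (fact n)) (- x) (f (- - x))).
  { apply Hser.
    - intros n t Ht.
      rewrite Derive_n_comp_opp by (apply Hloc; exact Ht).
      rewrite Rabs_mult, pow_1_abs, Rmult_1_l.
      apply Hbd; rewrite Rabs_Ropp; exact Ht.
    - apply Rabs_def2 in Hx; lra. }
  rewrite Ropp_involutive in H.
  apply is_pseries_R; apply is_pseries_R in H.
  revert H; apply is_series_ext; intro n.
  rewrite Derive_n_comp_opp by (apply Hloc; rewrite Rabs_R0; exact Hr).
  rewrite Ropp_0.
  replace (- x) with (-1 * x) by ring.
  rewrite Rpow_mult_distr.
  replace ((-1) ^ n * Derive_n f n 0 / INR (fact n) * ((-1) ^ n * x ^ n))
    with (((-1) ^ n * (-1) ^ n) * (Derive_n f n 0 / INR (fact n) * x ^ n))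
    by (unfold Rdiv; ring).
  rewrite <- Rpow_mult_distr.
  replace (-1 * -1) with 1 by ring.
  rewrite pow1; apply Rmult_1_l.
- replace (f 0) with (Derive_n f 0 0 / INR (fact 0)) by (simpl; field).
  apply (is_pseries_0 (fun n => Derive_n f n 0 / INR (fact n))).
- apply (taylor_series_of_cauchy_bound_pos f r K); try assumption.
  apply Rabs_def2 in Hx; lra.
Qed.

(** * Bessel numbers *)

(** The recurrence is the one produced by differentiating
    [sum_k k! B(n,k) y^(k+1) u^(2n-k)]. The factor [2n - k] is a difference of
    reals; it is negative only where the number it multiplies is [0]. *)
Fixpoint bessel (n k : nat) : R :=
  match n, k with
  | O, O => 1
  | O, S _ => 0
  | S m, O => INR (2 * m) * bessel m 0
  | S m, S i => bessel m i + (INR (2 * m) - INR (S i)) * bessel m (S i)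
  end.

Lemma bessel_succ_succ (n i : nat) :
  bessel (S n) (S i)
  = bessel n i + (INR (2 * n) - INR (S i)) * bessel n (S i).
Proof. reflexivity. Qed.

Lemma bessel_gt (n k : nat) : (n < k)%nat -> bessel n k = 0.
Proof.
revert k; induction n as [|n IH]; intros [|k] Hk; try lia; [reflexivity|].
rewrite bessel_succ_succ, !IH by lia; ring.
Qed.

Lemma bessel_nonneg (n k : nat) : 0 <= bessel n k.
Proof.
revert k; induction n as [|n IH]; intros [|k].
- simpl; lra.
- simpl; lra.
- apply Rmult_le_pos; [apply pos_INR|apply IH].
- rewrite bessel_succ_succ.
  destruct (Nat.le_gt_cases (S k) n) as [Hk|Hk].
  + apply Rplus_le_le_0_compat; [apply IH|].
    apply Rmult_le_pos; [|apply IH].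
    apply Rge_le, Rge_minus, Rle_ge, le_INR; lia.
  + rewrite (bessel_gt n (S k)) by lia.
    rewrite Rmult_0_r, Rplus_0_r; apply IH.
Qed.

Lemma bessel_succ_0 (n : nat) : bessel (S n) 0 = 0.
Proof.
induction n as [|n IH]; [simpl; ring|].
change (INR (2 * S n) * bessel (S n) 0 = 0); rewrite IH; ring.
Qed.

(** Let [N = i + 1 + d] and let [v] be the claimed value of [B(N,i+1)]. In
    [B(N,i+1) = B(N-1,i) + (i+2d-1) B(N-1,i+1)] the induction hypothesis makes
    the two summands [v * i/(i+2d)] and [v * 2d/(i+2d)], which add up to [v].
    The boundary cases [i = 0] and [d = 0] lose one summand each. *)
Lemma bessel_closed_form (i d : nat) :
  bessel (S i + d) (S i)
  = INR (fact (2 * d + i)) / (INR (fact i) * 2 ^ d * INR (fact d)).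
Proof.
remember (i + d)%nat as n eqn:Hn; revert i d Hn.
induction n as [|n IH]; intros i d Hn.
- assert (i = 0%nat) by lia; assert (d = 0%nat) by lia; subst.
  simpl; field.
- replace (S i + d)%nat with (S (S n)) by lia.
  rewrite bessel_succ_succ.
  replace (INR (2 * S n) - INR (S i)) with (2 * INR d + INR i - 1)
    by (rewrite Hn, mult_INR, plus_INR, !S_INR; simpl (INR 0); ring).
  destruct i as [|i].
  + rewrite bessel_succ_0.
    destruct d as [|d]; [lia|].
    replace (S n) with (S 0 + d)%nat by lia.
    rewrite (IH 0%nat d) by lia.
    replace (2 * S d + 0)%nat with (S (S (2 * d + 0))) by lia.
    rewrite !fact_simpl, !mult_INR, !S_INR, plus_INR, mult_INR.
    simpl (2 ^ S d); simpl (INR 0); simpl (INR 2); simpl (INR (fact 0)).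
    field.
    pose proof (INR_fact_neq_0 d); pose proof (pow_nonzero 2 d).
    pose proof (pos_INR d); repeat split; try lra; auto.
  + replace (bessel (S n) (S i))
      with (INR (fact (2 * d + i)) / (INR (fact i) * 2 ^ d * INR (fact d)))
      by (replace (S n) with (S i + d)%nat by lia; rewrite IH by lia; reflexivity).
    pose proof (INR_fact_neq_0 i); pose proof (pos_INR i).
    destruct d as [|d].
    * rewrite bessel_gt by lia.
      rewrite Nat.mul_0_r, !Nat.add_0_l, !fact_simpl, !mult_INR, !S_INR.
      simpl; field; lra.
    * replace (S n) with (S (S i) + d)%nat by lia.
      rewrite (IH (S i) d) by lia.
      replace (2 * S d + S i)%nat with (S (S (S (2 * d + i)))) by lia.
      replace (2 * S d + i)%nat with (S (S (2 * d + i))) by lia.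
      replace (2 * d + S i)%nat with (S (2 * d + i)) by lia.
      rewrite !fact_simpl, !mult_INR, !S_INR, plus_INR, mult_INR.
      simpl (2 ^ S d); simpl (INR 2).
      pose proof (INR_fact_neq_0 d); pose proof (pow_nonzero 2 d).
      pose proof (pos_INR d).
      field; repeat split; try lra; auto.
Qed.

(** * Binomial coefficients and double factorials *)

Lemma falling_eq_0 (m j : nat) : (m < j)%nat -> falling (Z.of_nat m) j = 0%Z.
Proof.
induction j as [|j IH]; intro Hj; [lia|simpl].
destruct (Nat.eq_dec m j) as [->|Hne].
- rewrite Z.sub_diag; apply Z.mul_0_r.
- rewrite IH by lia; reflexivity.
Qed.

Lemma falling_fact (i j : nat) :
  IZR (falling (Z.of_nat (j + i)) j) * INR (fact i) = INR (fact (j + i)).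
Proof.
revert i; induction j as [|j IH]; intro i; [simpl; ring|].
replace (S j + i)%nat with (j + S i)%nat by lia.
cbn [falling].
rewrite <- IH, mult_IZR, fact_simpl, mult_INR.
replace (Z.of_nat (j + S i) - Z.of_nat j)%Z with (Z.of_nat (S i)) by lia.
rewrite <- INR_IZR_INZ; ring.
Qed.

Lemma dfact_even (n : nat) : dfact (2 * Z.of_nat n) = 2 ^ n * INR (fact n).
Proof.
unfold dfact.
replace (0 <=? 2 * Z.of_nat n)%Z with true by (symmetry; apply Z.leb_le; lia).
replace (Z.to_nat (2 * Z.of_nat n)) with (2 * n)%nat by lia.
rewrite dfact_nat_even, mult_INR, pow_INR; reflexivity.
Qed.

Lemma dfact_odd (d : nat) :
  dfact (2 * Z.of_nat d - 1) = INR (fact (2 * d)) / (2 ^ d * INR (fact d)).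
Proof.
destruct d as [|d].
- change (dfact (- 2 * Z.of_nat 0 - 1) = 1 / (1 * 1)).
  rewrite dfact_neg_odd; simpl; field.
- unfold dfact.
  replace (0 <=? 2 * Z.of_nat (S d) - 1)%Z with true by (symmetry; apply Z.leb_le; lia).
  replace (Z.to_nat (2 * Z.of_nat (S d) - 1)) with (2 * d + 1)%nat by lia.
  induction d as [|d IH]; [simpl; field|].
  rewrite dfact_nat_odd, mult_INR.
  replace (2 * S d - 1)%nat with (2 * d + 1)%nat by lia.
  rewrite IH.
  replace (2 * S (S d))%nat with (S (S (2 * S d))) by lia.
  rewrite (fact_simpl (S (2 * S d))), (fact_simpl (2 * S d)), (fact_simpl (S d)).
  rewrite !mult_INR, plus_INR, mult_INR, !S_INR, mult_INR, !S_INR.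
  simpl (INR 0); simpl (2 ^ S (S d)); simpl (2 ^ S d).
  pose proof (INR_fact_neq_0 (S d)); pose proof (pow_nonzero 2 d).
  pose proof (pos_INR d).
  field; repeat split; try lra; auto.
Qed.

(** For [k = 0] both sides vanish unless [n = 0], as [binom(2n-1, 2n) = 0]. For
    [k >= 1] the factor [(2d)!] in the denominator of the binomial coefficient,
    with [d = n - k], cancels against [(2d-1)!! = (2d)! / (2^d d!)]. *)
Lemma bessel_binomZ_dfact (n k : nat) :
  (k <= n)%nat ->
  bessel n k
  = binomZ (2 * Z.of_nat n - Z.of_nat k - 1) (2 * (n - k))
    * dfact (2 * (Z.of_nat n - Z.of_nat k) - 1).
Proof.
intro Hk.
replace (Z.of_nat n - Z.of_nat k)%Z with (Z.of_nat (n - k)) by lia.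
destruct k as [|i].
- destruct n as [|n].
  + rewrite dfact_odd; unfold binomZ; simpl; field.
  + rewrite bessel_succ_0; unfold binomZ.
    replace (2 * Z.of_nat (S n) - Z.of_nat 0 - 1)%Z with (Z.of_nat (2 * n + 1)) by lia.
    rewrite falling_eq_0 by lia.
    unfold Rdiv; ring.
- rewrite dfact_odd.
  replace n with (S i + (n - S i))%nat at 1 by lia.
  set (d := (n - S i)%nat).
  replace (2 * Z.of_nat n - Z.of_nat (S i) - 1)%Z with (Z.of_nat (2 * d + i)) by lia.
  rewrite bessel_closed_form; unfold binomZ.
  rewrite <- (falling_fact i (2 * d)).
  pose proof (INR_fact_neq_0 i); pose proof (INR_fact_neq_0 d).
  pose proof (INR_fact_neq_0 (2 * d)); pose proof (pow_nonzero 2 d).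
  field; repeat split; try lra; auto.
Qed.

(** * Weighted sums of Bessel numbers *)

(** Keeping the weight [G] general lets one recurrence, [bessel_sum_succ],
    yield both the derivative formula ([G k = y^(k+1) u^(2n-k)]) and the size
    of the coefficients ([G = 1]). *)
Definition bessel_sum (n : nat) (G : nat -> R) : R :=
  sum_f_R0 (fun k => INR (fact k) * bessel n k * G k) n.

(** Summation by parts of the recurrence: [B(n,k)] enters [B(n+1,k+1)] with
    factor [1] and [B(n+1,k)] with factor [2n-k], and
    [(k+1)! = k! (k+1)]. *)
Lemma bessel_sum_succ (n : nat) (G : nat -> R) :
  bessel_sum (S n) G
  = bessel_sum n
      (fun k => INR (k + 1) * G (S k) + INR (2 * n - k) * G k).
Proof.
unfold bessel_sum.
(* [A] carries the summand [B(n,k-1)] of the recurrence; having none at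
   [k = 0], it is [0] there. *)
set (A := fun k => match k with
  | O => 0 | S i => INR (fact (S i)) * bessel n i * G (S i) end).
set (B := fun k => INR (fact k) * ((INR (2 * n) - INR k) * bessel n k) * G k).
transitivity (sum_f_R0 (fun k => A k + B k) (S n)).
{ apply sum_eq; intros [|i] _; unfold A, B.
  - change (bessel (S n) 0) with (INR (2 * n) * bessel n 0); simpl (INR 0); ring.
  - rewrite bessel_succ_succ; ring. }
rewrite sum_plus, (decomp_sum A) by lia.
rewrite (tech5 B); simpl (A 0%nat); simpl pred.
(* The top term of [B] vanishes since [B(n,n+1) = 0]. *)
unfold B at 2; rewrite bessel_gt by lia.
transitivity (sum_f_R0 (fun i => A (S i)) n + sum_f_R0 B n); [ring|].
rewrite <- sum_plus; apply sum_eq; intros k Hk.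
unfold A, B.
rewrite fact_simpl, mult_INR, S_INR, plus_INR, minus_INR by lia.
simpl (INR 1); ring.
Qed.

(** For [G = 1] the bracket in [bessel_sum_succ] is [(k+1) + (2n-k) = 2n+1],
    whatever [k], so the sum equals [1 * 3 * ... * (2n-1)]. *)
Lemma bessel_sum_one_le (n : nat) :
  bessel_sum n (fun _ => 1) <= 2 ^ n * INR (fact n).
Proof.
induction n as [|n IH]; [unfold bessel_sum; simpl; lra|].
rewrite bessel_sum_succ.
replace (bessel_sum n _) with (INR (2 * n + 1) * bessel_sum n (fun _ => 1)).
- rewrite fact_simpl, mult_INR; simpl (2 ^ S n).
  apply Rle_trans with (INR (2 * n + 1) * (2 ^ n * INR (fact n))).
  + apply Rmult_le_compat_l; [apply pos_INR|exact IH].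
  + replace (2 * 2 ^ n * (INR (S n) * INR (fact n)))
      with (INR (2 * S n) * (2 ^ n * INR (fact n)))
      by (rewrite mult_INR; simpl (INR 2); ring).
    apply Rmult_le_compat_r.
    * apply Rmult_le_pos; [apply pow_le; lra|apply pos_INR].
    * apply le_INR; lia.
- unfold bessel_sum; rewrite scal_sum; apply sum_eq; intros k Hk.
  replace (2 * n + 1)%nat with ((k + 1) + (2 * n - k))%nat by lia.
  rewrite (plus_INR (k + 1)); ring.
Qed.

(** * Higher derivatives of the generating function *)

Definition inv_sqrt (b x : R) : R := / sqrt (b - x).

Lemma is_derive_inv_sqrt (b x : R) :
  x < b -> is_derive (inv_sqrt b) x (inv_sqrt b x ^ 3 / 2).
Proof.
intro Hx; unfold inv_sqrt.
pose proof (sqrt_lt_R0 (b - x) ltac:(lra)) as Hs.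
auto_derive; change (b + - x) with (b - x); [repeat split; lra|].
field; lra.
Qed.

Lemma is_derive_gen_catalan2_fun (a b : R) (ha : 0 <= a) (x : R) :
  x < b ->
  is_derive (gen_catalan2_fun a b) x (gen_catalan2_fun a b x ^ 2 * inv_sqrt b x / 2).
Proof.
intro Hx; unfold inv_sqrt, gen_catalan2_fun.
pose proof (sqrt_lt_R0 (b - x) ltac:(lra)) as Hs.
auto_derive; change (b + - x) with (b - x); [repeat split; lra|].
field; lra.
Qed.

Definition bessel_deriv (a b : R) (n : nat) (x : R) : R :=
  bessel_sum n
    (fun k => gen_catalan2_fun a b x ^ (k + 1) * inv_sqrt b x ^ (2 * n - k))
  / 2 ^ n.

(** By the product rule each term splits in two, and [bessel_sum_succ]
    regroups the result by powers of [gen_catalan2_fun a b]. *)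
Lemma is_derive_bessel_deriv (a b : R) (ha : 0 <= a) (n : nat) (x : R) :
  x < b -> is_derive (bessel_deriv a b n) x (bessel_deriv a b (S n) x).
Proof.
intro Hx.
set (c := fun k => INR (fact k) * bessel n k).
apply is_derive_ext with
  (fun t => / 2 ^ n * sum_n (fun k =>
     c k * (gen_catalan2_fun a b t ^ (k + 1) * inv_sqrt b t ^ (2 * n - k))) n).
{ intro t; rewrite sum_n_Reals; unfold bessel_deriv, bessel_sum, c, Rdiv.
  apply Rmult_comm. }
replace (bessel_deriv a b (S n) x) with (/ 2 ^ n * sum_n (fun k => c k *
   ((INR (k + 1) * gen_catalan2_fun a b x ^ (k + 2) * inv_sqrt b x ^ (2 * n - k + 1)
     + INR (2 * n - k) * gen_catalan2_fun a b x ^ (k + 1)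
       * inv_sqrt b x ^ (2 * n - k + 2)) / 2)) n).
- apply is_derive_scal.
  apply (is_derive_sum_n (fun k t =>
    c k * (gen_catalan2_fun a b t ^ (k + 1) * inv_sqrt b t ^ (2 * n - k)))).
  intros k Hk; apply is_derive_scal.
  evar_last.
  { apply (is_derive_mult (fun t => gen_catalan2_fun a b t ^ (k + 1))
      (fun t => inv_sqrt b t ^ (2 * n - k))).
    - apply is_derive_pow, is_derive_gen_catalan2_fun; assumption.
    - apply is_derive_pow, is_derive_inv_sqrt, Hx.
    - exact Rmult_comm. }
  unfold plus, mult; simpl plus; simpl mult.
  replace (pred (k + 1)) with k by lia.
  rewrite !pow_add.
  (* The power rule for [u^m] involves [m - 1], truncated at [m = 0]. *)
  destruct (2 * n - k)%nat as [|m]; simpl; field.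
- rewrite sum_n_Reals; unfold bessel_deriv; rewrite bessel_sum_succ.
  unfold bessel_sum; rewrite scal_sum.
  unfold Rdiv; rewrite (Rmult_comm _ (/ 2 ^ S n)), scal_sum.
  apply sum_eq; intros k Hk; unfold c.
  replace (2 * S n - S k)%nat with (2 * n - k + 1)%nat by lia.
  replace (2 * S n - k)%nat with (2 * n - k + 2)%nat by lia.
  replace (S k + 1)%nat with (k + 2)%nat by lia.
  simpl (2 ^ S n); rewrite Rinv_mult; ring.
Qed.

Lemma Derive_n_gen_catalan2_fun (a b : R) (ha : 0 <= a) (n : nat) (x : R) :
  x < b -> Derive_n (gen_catalan2_fun a b) n x = bessel_deriv a b n x.
Proof.
revert x; induction n as [|n IH]; intros x Hx.
- unfold bessel_deriv, bessel_sum; simpl; field.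
- simpl Derive_n.
  apply is_derive_unique, is_derive_ext_loc with (bessel_deriv a b n);
    [|apply is_derive_bessel_deriv; assumption].
  apply (locally_interval _ x m_infty b); simpl; [exact I|exact Hx|].
  intros t _ Ht; symmetry; apply IH, Ht.
Qed.

Lemma ex_derive_n_gen_catalan2_fun (a b : R) (ha : 0 <= a) (n : nat) (x : R) :
  x < b -> ex_derive_n (gen_catalan2_fun a b) n x.
Proof.
intro Hx; destruct n as [|n]; [exact I|].
apply ex_derive_ext_loc with (bessel_deriv a b n);
  [|eexists; apply is_derive_bessel_deriv; assumption].
apply (locally_interval _ x m_infty b); simpl; [exact I|exact Hx|].
intros t _ Ht; symmetry; apply Derive_n_gen_catalan2_fun; assumption.
Qed.

(** Replacing [y] by the larger [u] makes every monomial [y^(k+1) u^(2n-k)]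
    equal to [u^(2n+1)], leaving only the sum of the coefficients. *)
Lemma Derive_n_gen_catalan2_fun_bound (a b : R) (ha : 0 <= a) (n : nat) (x : R) :
  x < b ->
  Rabs (Derive_n (gen_catalan2_fun a b) n x)
  <= inv_sqrt b x * INR (fact n) / (b - x) ^ n.
Proof.
intro Hx.
rewrite Derive_n_gen_catalan2_fun by assumption; unfold bessel_deriv.
pose proof (sqrt_lt_R0 (b - x) ltac:(lra)) as Hs.
assert (Hu : 0 < inv_sqrt b x) by (apply Rinv_0_lt_compat, Hs).
assert (Hy : 0 < gen_catalan2_fun a b x).
{ unfold gen_catalan2_fun; apply Rdiv_lt_0_compat; lra. }
assert (Hyu : gen_catalan2_fun a b x <= inv_sqrt b x).
{ unfold inv_sqrt, gen_catalan2_fun; unfold Rdiv; rewrite Rmult_1_l.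
  apply Rinv_le_contravar; lra. }
assert (Hu2 : inv_sqrt b x ^ (2 * n + 1) = inv_sqrt b x * / (b - x) ^ n).
{ rewrite pow_add, pow_mult, pow_1, Rmult_comm; f_equal.
  rewrite <- pow_inv; f_equal; unfold inv_sqrt.
  rewrite pow_inv, pow2_sqrt by lra; reflexivity. }
assert (H2n : 0 < 2 ^ n) by (apply pow_lt; lra).
rewrite Rabs_pos_eq.
2: { apply Rdiv_le_0_compat; [|exact H2n].
  apply cond_pos_sum; intro k.
  repeat apply Rmult_le_pos;
    [apply pos_INR|apply bessel_nonneg|apply pow_le; lra|apply pow_le; lra]. }
apply Rle_trans with (inv_sqrt b x ^ (2 * n + 1) * bessel_sum n (fun _ => 1) / 2 ^ n).
- apply Rmult_le_compat_r; [apply Rlt_le, Rinv_0_lt_compat, H2n|].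
  unfold bessel_sum; rewrite scal_sum; apply sum_Rle; intros k Hk.
  replace (2 * n + 1)%nat with ((k + 1) + (2 * n - k))%nat by lia.
  rewrite (pow_add _ (k + 1)), Rmult_1_r.
  apply Rmult_le_compat_l.
  + apply Rmult_le_pos; [apply pos_INR|apply bessel_nonneg].
  + apply Rmult_le_compat_r; [apply pow_le; lra|].
    apply pow_incr; lra.
- rewrite Hu2.
  apply Rle_trans with (inv_sqrt b x * / (b - x) ^ n * (2 ^ n * INR (fact n)) / 2 ^ n).
  + apply Rmult_le_compat_r; [apply Rlt_le, Rinv_0_lt_compat, H2n|].
    apply Rmult_le_compat_l; [|apply bessel_sum_one_le].
    rewrite <- Hu2; apply pow_le; lra.
  + apply Req_le; field; split; apply pow_nonzero; lra.
Qed.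

(** * The coefficients *)

(** At [x = 0], [y = u / (1 + a / sqrt b)], so that all monomials share the
    factor [u^(2n+1)]. *)
Lemma gen_catalan2_bessel (a b : R) (ha : 0 <= a) (n : nat) (hb : 0 < b) :
  gen_catalan2 a b n
  = / (2 ^ n * INR (fact n) * sqrt b ^ (2 * n + 1))
    * bessel_sum n (fun k => / (1 + a / sqrt b) ^ (k + 1)).
Proof.
unfold gen_catalan2.
pose proof (sqrt_lt_R0 b hb) as Hs.
assert (Hb : b - 0 = b) by ring.
rewrite Derive_n_gen_catalan2_fun by assumption; unfold bessel_deriv.
unfold bessel_sum, Rdiv; rewrite Rmult_assoc, Rmult_comm, !scal_sum.
apply sum_eq; intros k Hk.
unfold inv_sqrt, gen_catalan2_fun; rewrite Hb.
replace (1 / (a + sqrt b)) with (/ sqrt b * / (1 + a * / sqrt b))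
  by (field; repeat split; lra).
rewrite Rpow_mult_distr.
replace (2 * n + 1)%nat with ((k + 1) + (2 * n - k))%nat by lia.
rewrite (pow_add (sqrt b) (k + 1)), !Rinv_mult, !pow_inv; ring.
Qed.

Lemma Rpower_nat_plus_half (b : R) (n : nat) :
  0 < b -> Rpower b (INR n + 1 / 2) = sqrt b ^ (2 * n + 1).
Proof.
intro hb.
rewrite Rpower_plus, Rpower_pow by exact hb.
replace (1 / 2) with (/ 2) by field.
rewrite Rpower_sqrt by exact hb.
rewrite pow_add, pow_mult, pow2_sqrt by lra; ring.
Qed.

Theorem theorem2p1 (a b : R) (ha : 0 <= a) (hb : 0 < b) :
  locally (0 : R)
    (fun x : R => is_pseries (gen_catalan2 a b) x (1 / (a + sqrt (b - x))))
  /\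
  forall n : nat,
    gen_catalan2 a b n
    = 1 / (dfact (2 * Z.of_nat n) * Rpower b (INR n + 1 / 2))
      * sum_f_R0
          (fun k : nat =>
             binomZ (2 * Z.of_nat n - Z.of_nat k - 1) (2 * (n - k))
             * (INR (fact k) * dfact (2 * (Z.of_nat n - Z.of_nat k) - 1)
                / (1 + a / sqrt b) ^ (k + 1)))
          n.
Proof.
split.
- (* [|t| < b/2] forces [b - t > b/2], so [b/2] can be both the radius and the
     base of the powers in the Cauchy estimates. *)
  apply (locally_interval _ 0 (- (b / 2)) (b / 2)); simpl; try lra.
  intros x Hx1 Hx2.
  apply (taylor_series_of_cauchy_bound (gen_catalan2_fun a b) (b / 2) (/ sqrt (b / 2))).
  + intros n t Ht; apply ex_derive_n_gen_catalan2_fun; [exact ha|].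
    apply Rabs_def2 in Ht; lra.
  + intros n t Ht; apply Rabs_def2 in Ht.
    apply Rle_trans with (1 := Derive_n_gen_catalan2_fun_bound a b ha n t ltac:(lra)).
    assert (Hs : 0 < sqrt (b / 2)) by (apply sqrt_lt_R0; lra).
    assert (Hle : / sqrt (b - t) <= / sqrt (b / 2)).
    { apply Rinv_le_contravar; [exact Hs|apply sqrt_le_1_alt; lra]. }
    assert (Hs' : 0 < sqrt (b - t)) by (apply sqrt_lt_R0; lra).
    apply Rmult_le_compat.
    * apply Rmult_le_pos; [apply Rlt_le, Rinv_0_lt_compat, Hs'|apply pos_INR].
    * apply Rlt_le, Rinv_0_lt_compat, pow_lt; lra.
    * apply Rmult_le_compat_r; [apply pos_INR|exact Hle].
    * apply Rinv_le_contravar; [apply pow_lt; lra|apply pow_incr; lra].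
  + apply Rabs_def1; assumption.
- intro n.
  rewrite gen_catalan2_bessel, dfact_even, Rpower_nat_plus_half by assumption.
  rewrite Rdiv_1_l; f_equal.
  unfold bessel_sum; apply sum_eq; intros k Hk.
  rewrite bessel_binomZ_dfact by exact Hk.
  unfold Rdiv; ring.
Qed.
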